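(* Let $a=(a_t)_{t\ge 0}$ and $b=(b_t)_{t\ge 0}$ be the binary output sequences of two LFSRs over $GF(2)$ defined by primitive polynomials, with individual periods $n_1$ and $n_2$ respectively. Let $s_t=a_tb_t$ (product in $GF(2)$) be the reference product sequence, associated with the field $GF(2^m)$ and having period $n$ with $n\mid 2^m-1$. Let the initial states of the two LFSRs be shifted by $k_1$ and $k_2$ respectively, and let $u_t=a_{t+k_1}\,b_{t+k_2}$ be the resulting output sequence. Then $u_t$ is related to $s_t$ by $u_t=s_{t+\tau}$, where the shift $\tau$ is determined through the Chinese Remainder Theorem by $$\tau\equiv k_1 \pmod{n_1},\qquad \tau\equiv k_2 \pmod{n_2}.$$
   Context: An LFSR over $GF(2)$ with feedback polynomial $f(x)=x^p+\sum_{j=0}^{p-1}c_jx^j\in GF(2)[x]$ outputs a binary sequence satisfying $a_{t+p}=\sum_{j=0}^{p-1}c_j a_{t+j}$ for all $t\ge 0$; its initial state is $(a_0,\dots,a_{p-1})$. Shifting the initial state by $k$ means replacing it by $(a_k,\dots,a_{k+p-1})$, so that the output becomes $(a_{t+k})_{t\ge 0}$.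
   Formalization: Existence and uniqueness (mod n_1 n_2) of the shift τ are claimed only when n_1 and n_2 are coprime, since otherwise the congruences can have no solution (e.g. a = b, k_1 ≠ k_2 mod n_1); u_t = s_{t+τ} is proved for every τ satisfying both congruences. *)

(* Defs.v *)
From HB Require Import structures.
From mathcomp Require Import all_boot all_order all_algebra all_field.
Set Implicit Arguments.
Unset Strict Implicit.
Unset Printing Implicit Defensive.
Import GRing.Theory.
Local Open Scope ring_scope.

(* The feedback polynomial x^p + c_(p-1) x^(p-1) + ... + c_0 has size p + 1. *)
Definition lfsr_length (f : {poly 'F_2}) : nat := (size f).-1.

Definition lfsr_state (f : {poly 'F_2}) (a : nat -> 'F_2) (k : nat) :
  'rV['F_2]_(lfsr_length f) := \row_j a (k + j)%N.

(* [a] is the sequence output by the LFSR with feedback polynomial [f] started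
   in the initial state [x]. *)
Definition lfsr_output (f : {poly 'F_2}) (x : 'rV['F_2]_(lfsr_length f))
    (a : nat -> 'F_2) : Prop :=
  lfsr_state f a 0 = x /\
  forall t, a (t + lfsr_length f)%N =
            \sum_(j < lfsr_length f) f`_j * a (t + j)%N.

Definition seq_period (s : nat -> 'F_2) (n : nat) : Prop :=
  (0 < n)%N /\ forall t, s (t + n)%N = s t.

(* "The" period is the least one. *)
Definition has_period (s : nat -> 'F_2) (n : nat) : Prop :=
  seq_period s n /\ forall n', seq_period s n' -> (n <= n')%N.

(* Main.v *)
Require Import Defs.
From HB Require Import structures.
From mathcomp Require Import all_boot all_order all_algebra all_field.
Set Implicit Arguments.
Unset Strict Implicit.
Unset Printing Implicit Defensive.
Import GRing.Theory.
Local Open Scope ring_scope.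

(** The recurrence does not depend on time, so a register restarted from its state at time [k]
    replays its output from time [k] on ([lfsr_output_shift], [lfsr_output_unique]). Hence [u] is
    the product of the two shifted sequences. Each factor sees its index only modulo its own period
    ([seq_period_modn]), so one [tau] congruent to [k1] modulo [n1] and to [k2] modulo [n2] replaces
    both shifts. For coprime periods the Chinese Remainder Theorem provides it, uniquely modulo
    [n1 * n2]. *)

Lemma lfsr_output_unique (f : {poly 'F_2}) (x : 'rV['F_2]_(lfsr_length f))
    (a b : nat -> 'F_2) :
  lfsr_output x a -> lfsr_output x b -> a =1 b.
Proof.
move=> [a0 aS] [b0 bS]; elim/ltn_ind=> t IHt.
have [lt_t_p | le_p_t] := ltnP t (lfsr_length f).
  have /rowP/(_ (Ordinal lt_t_p)) := etrans a0 (esym b0).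
  by rewrite !mxE.
(* Past the initial window, the recurrence at [t - lfsr_length f] involves only indices below [t],
   where strong induction applies. *)
rewrite -(subnK le_p_t) aS bS; apply: eq_bigr => j _.
by rewrite IHt // -[ltnRHS](subnK le_p_t) ltn_add2l.
Qed.

Lemma lfsr_output_shift (f : {poly 'F_2}) (x : 'rV['F_2]_(lfsr_length f))
    (a : nat -> 'F_2) (k : nat) :
  lfsr_output x a -> lfsr_output (lfsr_state f a k) (fun t => a (t + k)%N).
Proof.
move=> [_ aS]; split=> [|t]; first by apply/rowP=> j; rewrite !mxE add0n addnC.
by rewrite addnAC aS; apply: eq_bigr => j _; rewrite addnAC.
Qed.

(** Removing the multiples of [n] one at a time reduces each index to its remainder. *)
Lemma seq_period_modn (s : nat -> 'F_2) (n i j : nat) :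
  seq_period s n -> i = j %[mod n] -> s i = s j.
Proof.
move=> [_ sn] eq_ij.
have s_mod t : s t = s (t %% n)%N.
  rewrite {1}(divn_eq t n) addnC; elim: (t %/ n)%N => [|q IHq].
    by rewrite mul0n addn0.
  by rewrite mulSnr addnA sn.
by rewrite s_mod eq_ij -s_mod.
Qed.

Theorem theorem1
  (f1 f2 : {poly 'F_2}) (hf1 : primitive_poly f1) (hf2 : primitive_poly f2)
  (x1 : 'rV['F_2]_(lfsr_length f1)) (x2 : 'rV['F_2]_(lfsr_length f2))
  (a b : nat -> 'F_2)
  (ha : lfsr_output x1 a) (hb : lfsr_output x2 b)
  (n1 n2 : nat) (hn1 : has_period a n1) (hn2 : has_period b n2)
  (s : nat -> 'F_2) (hs : forall t, s t = a t * b t)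
  (m n : nat) (F : finFieldType) (hF : #|F| = (2 ^ m)%N)
  (hn : has_period s n) (hnm : (n %| 2 ^ m - 1)%N)
  (k1 k2 : nat) (a' b' : nat -> 'F_2)
  (ha' : lfsr_output (lfsr_state f1 a k1) a')
  (hb' : lfsr_output (lfsr_state f2 b k2) b')
  (u : nat -> 'F_2) (hu : forall t, u t = a' t * b' t) :
  [/\ forall t, u t = a (t + k1)%N * b (t + k2)%N,
      forall tau : nat,
        tau = k1 %[mod n1] -> tau = k2 %[mod n2] ->
        forall t, u t = s (t + tau)%N
    & coprime n1 n2 ->
      exists tau : nat,
        [/\ tau = k1 %[mod n1], tau = k2 %[mod n2],
            forall tau' : nat, tau' = k1 %[mod n1] -> tau' = k2 %[mod n2] ->
              tau' = tau %[mod n1 * n2]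
          & forall t, u t = s (t + tau)%N]].
Proof.
have u_shift t : u t = a (t + k1)%N * b (t + k2)%N.
  by rewrite hu (lfsr_output_unique ha' (lfsr_output_shift k1 ha))
             (lfsr_output_unique hb' (lfsr_output_shift k2 hb)).
have u_crt tau : tau = k1 %[mod n1] -> tau = k2 %[mod n2] ->
    forall t, u t = s (t + tau)%N.
  move=> tau1 tau2 t; rewrite u_shift hs; congr (_ * _).
    (* The indices [t + k1] and [t + tau] agree modulo [n1]; the second factor is treated alike
       modulo [n2]. *)
    by apply: (seq_period_modn hn1.1); rewrite -modnDmr -tau1 modnDmr.
  by apply: (seq_period_modn hn2.1); rewrite -modnDmr -tau2 modnDmr.
split=> // co_n.
have tau1 := chinese_modl co_n k1 k2; have tau2 := chinese_modr co_n k1 k2.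
exists (chinese n1 n2 k1 k2); split=> // [tau' tau'1 tau'2|]; last exact: u_crt.
(* By coprimality, congruence modulo [n1 * n2] splits into congruences modulo [n1] and modulo [n2],
   where both solutions have the prescribed residues. *)
by apply/eqP; rewrite chinese_remainder // tau'1 tau'2 tau1 tau2 !eqxx.
Qed.
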